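(* The assertion that, for General Variable Branching (GVB), it is never strictly optimal to branch on a dominated variable before those that dominate it is false. That is, there exists an instance of GVB (variables $(l_1,r_1),\dots,(l_n,r_n)$, multiplicities $m \in \mathbb{Z}_{>0}^n$, gap $G>0$) and a variable $i$ dominated by another variable of the instance such that it is strictly optimal to branch on $i$ at the root: there is a feasible tree closing the gap $G$ whose root branches on variable $i$ and which has strictly fewer nodes than every feasible tree closing the gap $G$ whose root branches on a variable $j \ne i$.
   Context: A variable is a pair $(l,r)$ of integers with $1 \le l \le r$. Variable $(l_1,r_1)$ dominates $(l_2,r_2)$ if $l_1 \ge l_2$ and $r_1 \ge r_2$ with at least one of $l_1 > l_2$ or $r_1 > r_2$. A branch-and-bound tree is a vertex-weighted full binary tree in which each internal node is associated with a variable $(l_i,r_i)$ of the instance (the node ''branches on'' $i$), such that an internal node of weight $g$ has children of weights $g+l_i$ and $g+r_i$; the root has weight $0$. The tree closes the gap $G$ if all its leaves have weight at least $G$. It is feasible for a GVB instance with multiplicities $m$ if each variable $i$ is branched on at most $m_i$ times on each path from the root to a leaf. The GVB problem seeks a feasible tree with the minimum number of nodes closing the gap $G$. *)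

(* Defs.v *)
From mathcomp Require Import all_boot.

Set Implicit Arguments.
Unset Strict Implicit.
Unset Printing Implicit Defensive.

Record bvar := BVar {
  lgain : nat;
  rgain : nat;
  lgain_gt0 : 1 <= lgain;
  lgain_le_rgain : lgain <= rgain
}.

Definition dominates (v1 v2 : bvar) : bool :=
  [&& lgain v2 <= lgain v1, rgain v2 <= rgain v1 &
      (lgain v2 < lgain v1) || (rgain v2 < rgain v1)].

(* Variables are referred to by their index, so two indices may carry the same
   pair of gains. *)
Record gvb := GVB {
  nvars : nat;
  var : 'I_nvars -> bvar;
  mult : 'I_nvars -> nat;
  gap : nat;
  mult_gt0 : forall i, 0 < mult i;
  gap_gt0 : 0 < gap
}.

(* Full binary trees; the weights are not stored, since they are determined by
   the weight of the root and the variables branched on. *)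
Inductive bbtree (n : nat) :=
  | Leaf
  | Node of 'I_n & bbtree n & bbtree n.

Arguments Leaf {n}.

Fixpoint num_nodes n (t : bbtree n) : nat :=
  if t is Node _ tl tr then (num_nodes tl + num_nodes tr).+1 else 1.

Definition root_var n (t : bbtree n) : option 'I_n :=
  if t is Node i _ _ then Some i else None.

(* The weights of the leaves of [t] when its root has weight [g]. *)
Fixpoint leaf_weights n (v : 'I_n -> bvar) (g : nat) (t : bbtree n) : seq nat :=
  if t is Node i tl tr then
    leaf_weights v (g + lgain (v i)) tl ++ leaf_weights v (g + rgain (v i)) tr
  else [:: g].

(* One entry per leaf: the variables branched on along the path from the root
   to that leaf. *)
Fixpoint paths n (t : bbtree n) : seq (seq 'I_n) :=
  if t is Node i tl tr then [seq i :: p | p <- paths tl ++ paths tr]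
  else [:: [::]].

Definition closes_gap (I : gvb) (t : bbtree (nvars I)) : Prop :=
  forall w, w \in leaf_weights (@var I) 0 t -> gap I <= w.

Definition feasible (I : gvb) (t : bbtree (nvars I)) : Prop :=
  forall p, p \in paths t -> forall i, count_mem i p <= mult i.

Definition strictly_optimal_at_root (I : gvb) (i : 'I_(nvars I)) : Prop :=
  exists t : bbtree (nvars I),
    [/\ feasible t, closes_gap t, root_var t = Some i &
        forall (j : 'I_(nvars I)) (t' : bbtree (nvars I)),
          j <> i -> feasible t' -> closes_gap t' -> root_var t' = Some j ->
          num_nodes t < num_nodes t'].

(* Main.v *)
Require Import Defs.
From mathcomp Require Import all_boot.

Set Implicit Arguments.
Unset Strict Implicit.
Unset Printing Implicit Defensive.

(** The counterexample has variables a = (2,4), available twice, and b = (4,4)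
    and c = (2,5), available once each, with gap 7. Both b and c dominate a, but
    it is best to branch on a first: what remains to be gained is then 5 on the
    left and 3 on the right. On the right a single b is enough. On the left c
    leaves 3 and 0, and the 3 is again closed by a single b. This tree has 9
    nodes; it uses each of the scarce variables exactly where its larger gain
    matters.

    Branching on b or c at the root spends it too early. After b, a gain of 3
    is missing on both sides and every remaining variable has left gain 2, so
    each side needs at least two internal nodes, that is 5 nodes: 11 in total.
    After c, a gain of 5 is missing on the left and every remaining variable has
    right gain 4, so neither child of the next node can be a leaf and the left
    side needs 7 nodes; the right side still misses 2 and needs 3 nodes: again
    11 in total.

    Only the first two levels of a tree matter for these bounds, so they follow
    from [num_nodes_short_left], [num_nodes_short_right] and the fact that a
    variable of multiplicity one cannot be branched on at two consecutive
    levels ([feasible_root_neq]). *)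

Section LowerBounds.

Variables (n : nat) (v : 'I_n -> bvar) (G : nat).
Implicit Types (g : nat) (i : 'I_n) (t : bbtree n).

Definition closes_from g t := all (leq G) (leaf_weights v g t).

Lemma closes_from_Node g i tl tr :
  closes_from g (Node i tl tr) =
  closes_from (g + lgain (v i)) tl && closes_from (g + rgain (v i)) tr.
Proof. by rewrite /closes_from /= all_cat. Qed.

Lemma num_nodes_gt0 t : 0 < num_nodes t.
Proof. by case: t. Qed.

Lemma closes_from_short g t : g < G -> closes_from g t ->
  exists i tl tr, t = Node i tl tr.
Proof.
move=> ltgG; case: t => [|i tl tr _]; last by exists i, tl, tr.
by rewrite /closes_from /= andbT leqNgt ltgG.
Qed.

Lemma num_nodes_short g t : g < G -> closes_from g t -> 3 <= num_nodes t.
Proof.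
move=> ltgG /(closes_from_short ltgG) [i [tl [tr ->]]] /=.
by rewrite ltnS (leq_add (num_nodes_gt0 tl) (num_nodes_gt0 tr)).
Qed.

Lemma num_nodes_short_left g i tl tr : g + lgain (v i) < G ->
  closes_from g (Node i tl tr) -> 5 <= num_nodes (Node i tl tr).
Proof.
rewrite closes_from_Node => ltlG /andP[/(num_nodes_short ltlG) le3l _] /=.
by rewrite ltnS (leq_add le3l (num_nodes_gt0 tr)).
Qed.

(** The left gain never exceeds the right one, so when the right child has not
    reached the gap, neither child is a leaf. *)
Lemma num_nodes_short_right g i tl tr : g + rgain (v i) < G ->
  closes_from g (Node i tl tr) -> 7 <= num_nodes (Node i tl tr).
Proof.
rewrite closes_from_Node => ltrG.
have ltlG : g + lgain (v i) < G.
  by apply: leq_ltn_trans ltrG; rewrite leq_add2l lgain_le_rgain.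
move=> /andP[/(num_nodes_short ltlG) le3l /(num_nodes_short ltrG) le3r] /=.
by rewrite ltnS (leq_add le3l le3r).
Qed.

End LowerBounds.

Lemma paths_nonempty n (t : bbtree n) : exists p, p \in paths t.
Proof.
elim: t => [|i tl [p pP] tr _] /=; first by exists [::]; rewrite inE.
by exists (i :: p); rewrite map_f // mem_cat pP.
Qed.

Lemma root_var_path n (t : bbtree n) i :
  root_var t = Some i -> exists p, i :: p \in paths t.
Proof.
case: t => [//|j tl tr [<-]].
have [p pP] := paths_nonempty tl.
by exists p; rewrite /= map_f // mem_cat pP.
Qed.

Lemma feasible_root_neq (I : gvb) (j : 'I_(nvars I)) tl tr :
    mult j = 1 -> feasible (Node j tl tr) ->
  root_var tl <> Some j /\ root_var tr <> Some j.
Proof.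
move=> mj1 feas.
have no_repeat p : j :: p \notin paths tl ++ paths tr.
  apply/negP => jpP; have := feas (j :: j :: p) (map_f _ jpP) j.
  by rewrite mj1 /= eqxx.
split=> /root_var_path [p pP]; move: (no_repeat p).
  by rewrite mem_cat pP.
by rewrite mem_cat pP orbT.
Qed.

Definition var_a := BVar (isT : 1 <= 2) (isT : 2 <= 4).
Definition var_b := BVar (isT : 1 <= 4) (isT : 4 <= 4).
Definition var_c := BVar (isT : 1 <= 2) (isT : 2 <= 5).

Definition ex_var (i : 'I_3) : bvar :=
  match val i with 0 => var_a | 1 => var_b | _ => var_c end.
Definition ex_mult (i : 'I_3) : nat := if val i is 0 then 2 else 1.

Lemma ex_mult_gt0 i : 0 < ex_mult i.
Proof. by case: i => [[]]. Qed.

Definition ex_gvb := GVB ex_var ex_mult_gt0 (isT : 0 < 7).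

Definition ia : 'I_3 := Ordinal (isT : 0 < 3).
Definition ib : 'I_3 := Ordinal (isT : 1 < 3).
Definition ic : 'I_3 := Ordinal (isT : 2 < 3).

Lemma ord3P (i : 'I_3) : [\/ i = ia, i = ib | i = ic].
Proof.
case: i => [[|[|[|//]]] lt_i3];
  [apply: Or31 | apply: Or32 | apply: Or33]; exact: val_inj.
Qed.

Definition tree_a : bbtree 3 :=
  Node ia (Node ic (Node ib Leaf Leaf) Leaf) (Node ib Leaf Leaf).

Lemma tree_a_feasible : @feasible ex_gvb tree_a.
Proof.
move=> p pP i; move: p pP; apply/allP.
by have [->|->|->] := ord3P i.
Qed.

Lemma tree_a_closes_gap : @closes_gap ex_gvb tree_a.
Proof. by apply/allP. Qed.

(** Once b is spent, only the left gain 2 is available against a deficit of 3. *)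
Lemma num_nodes_after_b (t : bbtree 3) : root_var t <> Some ib ->
  closes_from ex_var 7 4 t -> 5 <= num_nodes t.
Proof.
move=> rt ct; have [i [tl [tr def_t]]] := closes_from_short (isT : 4 < 7) ct.
move: rt ct; rewrite {}def_t /= => neq_ib.
by apply: num_nodes_short_left; have [Ei|Ei|Ei] := ord3P i; rewrite Ei in neq_ib *.
Qed.

(** Once c is spent, only the right gain 4 is available against a deficit of 5. *)
Lemma num_nodes_after_c (t : bbtree 3) : root_var t <> Some ic ->
  closes_from ex_var 7 2 t -> 7 <= num_nodes t.
Proof.
move=> rt ct; have [i [tl [tr def_t]]] := closes_from_short (isT : 2 < 7) ct.
move: rt ct; rewrite {}def_t /= => neq_ic.
by apply: num_nodes_short_right; have [Ei|Ei|Ei] := ord3P i; rewrite Ei in neq_ic *.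
Qed.

Lemma num_nodes_root_neq_a (j : 'I_3) (t : bbtree 3) :
    j <> ia -> @feasible ex_gvb t -> @closes_gap ex_gvb t ->
  root_var t = Some j -> 11 <= num_nodes t.
Proof.
case: t => [//|k tl tr] neq_ja feas /allP clos [Ek]; subst k.
have {clos} : closes_from ex_var 7 0 (Node j tl tr) := clos.
rewrite closes_from_Node => /andP[cl cr] /=.
have [Ej|Ej|Ej] := ord3P j; subst j => //; rewrite ltnS.
- have [neq_l neq_r] := @feasible_root_neq ex_gvb ib _ _ erefl feas.
  exact: leq_add (num_nodes_after_b neq_l cl) (num_nodes_after_b neq_r cr).
- have [neq_l _] := @feasible_root_neq ex_gvb ic _ _ erefl feas.
  exact: leq_add (num_nodes_after_c neq_l cl) (num_nodes_short (isT : 5 < 7) cr).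
Qed.

Theorem theorem4 :
  exists (I : gvb) (i : 'I_(nvars I)),
    (exists k : 'I_(nvars I), dominates (var k) (var i)) /\
    strictly_optimal_at_root i.
Proof.
exists ex_gvb, ia; split; first by exists ib.
exists tree_a; split=> //; first exact: tree_a_feasible.
  exact: tree_a_closes_gap.
move=> j t neq_ja feas clos rt.
exact: leq_trans (num_nodes_root_neq_a neq_ja feas clos rt).
Qed.
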